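(* There exist distributions $\mathcal{D}$ over $\mathbb{R}^2_{\ge0}$ (two items) such that $\mathrm{Rev}(\mathcal{D})/\mathrm{ARev}(\mathcal{D})=\infty$.
   Context: Setting: one seller, one additive buyer, $k$ items; the buyer's value vector $\vec v\in\mathbb{R}^k_{\ge0}$ is drawn from a (possibly correlated) distribution $\mathcal{D}$. A mechanism $M$ is a set of options $(\vec q,p)$ with $\vec q\in[0,1]^k$, $p\in\mathbb{R}$, always containing the null option $(\vec 0,0)$; a buyer with values $\vec v$ selects an option maximizing $\vec v\cdot\vec q-p$ (ties broken arbitrarily; a maximizer is assumed to exist), and $\vec q^M(\vec v),p^M(\vec v)$ denote the allocation and price of the selected option. $\mathrm{Rev}(\mathcal{D},M)=\mathbb{E}_{\vec v\sim\mathcal{D}}[p^M(\vec v)]$, $\mathrm{Rev}(\mathcal{D})=\sup_M \mathrm{Rev}(\mathcal{D},M)$ (possibly $\infty$). The aligned revenue is $\mathrm{ARev}(\mathcal{D},M):=\mathbb{E}_{\vec v\sim\mathcal{D}}[p^M(\vec v)\cdot \mathbf{1}(\vec v \text{ is parallel to } \vec q^M(\vec v))]$ and $\mathrm{ARev}(\mathcal{D}):=\sup_M\mathrm{ARev}(\mathcal{D},M)$. *)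

(* Defs.v *)
From HB Require Import structures.
From mathcomp Require Import all_boot all_order all_algebra.
From mathcomp Require Import all_classical all_reals all_analysis.
Set Implicit Arguments. Unset Strict Implicit. Unset Printing Implicit Defensive.
Import Order.TTheory GRing.Theory Num.Theory.
Local Open Scope classical_set_scope.
Local Open Scope ring_scope.

Section Auction.
Variable R : realType.

(* A value vector is a pair (v1, v2) : (R * R)%type; an option is ((q1, q2), p). *)
Definition option2 := (((R * R)%type) * R)%type.

Definition util (v : (R * R)%type) (o : option2) : R :=
  v.1 * o.1.1 + v.2 * o.1.2 - o.2.

Definition is_mechanism (M : set option2) : Prop :=
  M ((0, 0), 0) /\
  forall o, M o -> (0 <= o.1.1 <= 1) /\ (0 <= o.1.2 <= 1).

Definition is_selection (M : set option2) (sel : (R * R)%type -> option2) : Prop :=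
  measurable_fun setT sel /\
  forall v : (R * R)%type, 0 <= v.1 -> 0 <= v.2 ->
    M (sel v) /\ forall o, M o -> util v o <= util v (sel v).

Definition parallel (v q : (R * R)%type) : bool := v.1 * q.2 == v.2 * q.1.

Definition rev_mech (P : probability ((R * R)%type) R) (sel : (R * R)%type -> option2)
  : \bar R := (\int[P]_v ((sel v).2)%:E)%E.

Definition arev_mech (P : probability ((R * R)%type) R) (sel : (R * R)%type -> option2)
  : \bar R :=
  (\int[P]_v ((sel v).2 * (if parallel v (sel v).1 then 1 else 0))%:E)%E.

Definition Rev (P : probability ((R * R)%type) R) : \bar R :=
  ereal_sup [set r | exists M sel, is_mechanism M /\ is_selection M sel /\
                                   r = rev_mech P sel].

Definition ARev (P : probability ((R * R)%type) R) : \bar R :=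
  ereal_sup [set r | exists M sel, is_mechanism M /\ is_selection M sel /\
                                   r = arev_mech P sel].

Definition nonneg_supported (P : probability ((R * R)%type) R) : Prop :=
  P [set v | 0 <= v.1 /\ 0 <= v.2] = 1%E.

End Auction.

(* Main.v *)
Require Import Defs.
From HB Require Import structures.
From mathcomp Require Import all_boot all_order all_algebra.
From mathcomp Require Import all_classical all_reals all_analysis.
From mathcomp Require Import measurable_realfun lra.
Import Order.TTheory GRing.Theory Num.Theory.
Set Implicit Arguments.
Unset Strict Implicit.
Local Open Scope classical_set_scope.
Local Open Scope ring_scope.

(** The value vectors are [v_i = 2^i (1, s_i)], drawn with probability
    [2^-(i+1)].  Then a mechanism earns at [v_i] at most about [2^i] times the gap
    [(q_i - q_j) . (1, s_i)] over the allocations [q_j] of earlier points, and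
    the expected revenue is comparable to the sum of these gaps.

    The slopes [s_i] sweep repeatedly, increasingly, from [0] to [w].  A sweep
    of width [w] with [N] points is matched by allocations whose second
    coordinate runs through [0, 1/N, 2/N, ...] and whose first coordinate makes
    [(1, s_i)] normal to a parabola of curvature [w]; consecutive gaps are
    [w / (2 N^2)], and it suffices to lift each parabola by [w / (2 N^2)] above
    the previous one.  So the sum of all [w / N] should diverge (total gap)
    while that of [w / N^2] converges (total lift).

    If instead [q_i = r_i (1, s_i)] is aligned, the gap of [i] over [j] is
    [r_i (1 + s_i^2) - r_j (1 + s_j^2) + r_j s_j (s_j - s_i)].  Along the chain
    of aligned points the first two terms telescope and the last one is
    positive only between two sweeps, where it is at most [w^2]; so the sum of
    all [w^2] should converge.

    Taking [N = 2^m] and [w] proportional to [4^-m] for the points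
    [16^m <= i < 16^(m+1)], which form [15 * 8^m] sweeps, achieves all three;
    the gap at [i] is then of order [1 / i]. *)

(** * Index arithmetic: levels, and shells of consecutive indices, one per sweep *)

Definition level (i : nat) : nat := trunc_log 16 i.

Definition shell_size (i : nat) : nat := (2 ^ level i)%N.

Definition shell_start (i : nat) : nat := (i %/ shell_size i * shell_size i)%N.

Lemma shell_size_gt0 i : (0 < shell_size i)%N.
Proof. by rewrite expn_gt0. Qed.

Lemma leq_level j i : (j <= i)%N -> (level j <= level i)%N.
Proof. exact: leq_trunc_log. Qed.

Lemma exp_level_leS i : (16 ^ level i <= i.+1)%N.
Proof.
case: i => [|i]; first by rewrite /level trunc_log0.
by apply: leq_trans (leqnSn _); exact: trunc_logP.
Qed.

(** The shell size [2^m] divides [16^(m+1)], so no shell straddles two levels. *)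
Lemma shell_end_le j : (shell_start j + shell_size j <= 16 ^ (level j).+1)%N.
Proof.
have dvd : (shell_size j %| 16 ^ (level j).+1)%N.
  by rewrite /shell_size -(expnM 2 4); apply: dvdn_exp2l;
    rewrite (leq_trans (leqnSn _)) ?leq_pmull.
rewrite -(divnK dvd) -mulSnr leq_mul2r; apply/orP; right.
by rewrite ltn_divRL // /shell_start (leq_ltn_trans (leq_divM _ _))
  ?trunc_log_ltn.
Qed.

Lemma level_shell j l :
  (l < shell_start j + shell_size j)%N -> (level l <= level j)%N.
Proof.
move=> lt_l; have := leq_trans lt_l (shell_end_le j).
case: l lt_l => [|l] _; first by rewrite /level trunc_log0.
move=> lt_l; rewrite -ltnS -(@ltn_exp2l 16) //.
by apply: leq_ltn_trans lt_l; exact: trunc_logP.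
Qed.

Lemma shell_dichotomy j i : (j < i)%N ->
  (level i = level j /\ shell_start i = shell_start j) \/
  (shell_start j + shell_size j <= shell_start i)%N.
Proof.
move=> lt_ji; have := leq_level (ltnW lt_ji).
rewrite leq_eqVlt => /orP[/eqP eq_lvl|lt_lvl].
  rewrite /shell_start /shell_size -eq_lvl.
  have := leq_div2r (2 ^ level j) (ltnW lt_ji).
  rewrite leq_eqVlt => /orP[/eqP->|lt_div]; first by left.
  by right; rewrite -mulSnr leq_mul2r lt_div orbT.
right; apply: leq_trans (shell_end_le j) _.
apply: (@leq_trans (16 ^ level i)); first by rewrite leq_exp2l.
have dvd : (shell_size i %| 16 ^ level i)%N.
  by rewrite /shell_size -(expnM 2 4); apply: dvdn_exp2l; rewrite leq_pmull.
rewrite -(divnK dvd) leq_mul2r; apply/orP; right; apply: leq_div2r.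
case: i lt_ji {dvd lt_lvl} => // i _; exact: trunc_logP.
Qed.

(** * The bounded lift shared by both halves of the argument *)

Section Sequences.
Variable R : realType.

(* Over one shell, [height] grows by [N / 32^m = 16^-m], which up to constants
   is both the lift [w / N^2] and the square [w^2]. *)
Definition height (n : nat) : R := \sum_(0 <= l < n) 32^-1 ^+ level l.

Lemma height_ge0 n : 0 <= height n.
Proof. by apply: sumr_ge0 => l _; rewrite exprn_ge0 // invr_ge0. Qed.

Lemma height_le m n : (m <= n)%N -> height m <= height n.
Proof.
move=> le_mn; rewrite /height (big_cat_nat (leq0n _) le_mn) //= lerDl.
by apply: sumr_ge0 => l _; rewrite exprn_ge0 // invr_ge0.
Qed.

(** Level [m] contributes [15 * 16^m / 32^m = 15 * 2^-m], a geometric series; index [0], also of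
    level [0], adds [1]. *)
Lemma height_exp M : height (16 ^ M.+1) = 31 - 15 * 2^-1 ^+ M.
Proof.
elim: M => [|M IH].
  rewrite /height big_nat (eq_bigr (fun=> 1)).
    by rewrite -big_nat sumr_const_nat expr0 subn0; lra.
  by move=> l /andP[_ lt_l]; rewrite [level l](_ : _ = 0%N) // ; apply/eqP;
    rewrite trunc_log_eq0 /=.
rewrite /height (@big_cat_nat _ _ _ (16 ^ M.+1)) ?leq_exp2l //= -/(height _) IH.
rewrite big_nat (eq_bigr (fun=> 32^-1 ^+ M.+1)); last first.
  move=> l /andP[ge_l lt_l]; congr (_ ^+ _).
  by apply: trunc_log_eq => //; rewrite ge_l.
rewrite -big_nat sumr_const_nat expnS -[X in (_ - X)%N]mul1n -mulnBl.
rewrite -[X in _ + X]mulr_natl natrM natrX -mulrA -exprMn.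
have -> : 16%:R * 32^-1 = 2^-1 :> R by lra.
rewrite exprS (_ : (16 - 1)%N = 15%N) //.
by set x := _ ^+ M; lra.
Qed.

Lemma height_le31 n : height n <= 31.
Proof.
apply: (@le_trans _ _ (height (16 ^ n.+1))).
  by apply: height_le; exact/ltnW/ltnW/ltn_expl.
by rewrite height_exp gerBl mulr_ge0 // exprn_ge0.
Qed.

Lemma height_shell j i : (shell_start j + shell_size j <= shell_start i)%N ->
  16^-1 ^+ level j <= height (shell_start i) - height (shell_start j).
Proof.
move=> le_ji; apply: (@le_trans _ _
    (height (shell_start j + shell_size j) - height (shell_start j))).
  rewrite /height (big_cat_nat (leq0n _) (leq_addr (shell_size j) _)) //=
    addrAC subrr add0r.
  apply: (@le_trans _ _
      (\sum_(shell_start j <= l < shell_start j + shell_size j)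
        32^-1 ^+ level j)).
    rewrite sumr_const_nat addKn -[leRHS]mulr_natl /shell_size natrX -exprMn.
    by rewrite (_ : 2 * 32^-1 = 16^-1) //; lra.
  apply: ler_sum_nat => l /andP[_ lt_l].
  by apply: ler_wiXn2l; rewrite ?invr_ge0 ?invf_le1 ?ler1n //;
    exact: level_shell.
by rewrite lerB // height_le.
Qed.

End Sequences.

(** * Slopes, allocations and their gaps *)

Section Points.
Variable R : realType.
Local Notation height := (@height R).

Definition shell_frac (i : nat) : R :=
  (i %% shell_size i)%:R / (shell_size i)%:R.

(* The factor [64^-1] keeps [alloc] inside the unit square. *)
Definition width (i : nat) : R := 64^-1 * 4^-1 ^+ level i.

Definition slope (i : nat) : R := width i * shell_frac i.

Definition alloc (i : nat) : R * R :=
  (2^-1 + 128^-1 * height (shell_start i) - width i * shell_frac i ^+ 2 / 2,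
   shell_frac i).

(** Up to a bounded factor this is [w / (2 N^2) = 16^-m / 128], in a form that leads directly to the
    harmonic series. *)
Definition gap (i : nat) : R := (128 * i.+1%:R)^-1.

Lemma shell_frac_ge0 i : 0 <= shell_frac i.
Proof. by rewrite divr_ge0. Qed.

Lemma shell_frac_le1 i : shell_frac i <= 1.
Proof.
rewrite ler_pdivrMr ?ltr0n ?shell_size_gt0 // mul1r ler_nat.
by rewrite ltnW // ltn_mod shell_size_gt0.
Qed.

Lemma width_ge0 i : 0 <= width i.
Proof. by rewrite mulr_ge0 ?exprn_ge0 // invr_ge0. Qed.

Lemma width_anti j i : (j <= i)%N -> width i <= width j.
Proof.
move=> le_ji; rewrite ler_wpM2l ?invr_ge0 //.
by apply: ler_wiXn2l; rewrite ?invr_ge0 ?invf_le1 ?ler1n //; exact: leq_level.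
Qed.

Lemma width_le i : width i <= 64^-1.
Proof.
by rewrite ler_piMr ?invr_ge0 // exprn_ile1 ?invr_ge0 ?invf_le1 ?ler1n.
Qed.

Lemma slope_ge0 i : 0 <= slope i.
Proof. by rewrite mulr_ge0 ?width_ge0 ?shell_frac_ge0. Qed.

Lemma slope_le_width i : slope i <= width i.
Proof. by rewrite ler_piMr ?width_ge0 ?shell_frac_le1. Qed.

Lemma slope_le1 i : slope i <= 1.
Proof. by have := slope_le_width i; have := width_le i; lra. Qed.

Lemma alloc_bounds i : (0 <= (alloc i).1 <= 1) /\ (0 <= (alloc i).2 <= 1).
Proof.
split; last by rewrite shell_frac_ge0 shell_frac_le1.
have h0 := height_ge0 R (shell_start i).
have h1 := @height_le31 R (shell_start i).
have f0 : 0 <= shell_frac i ^+ 2 by rewrite exprn_ge0 ?shell_frac_ge0.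
have f1 : shell_frac i ^+ 2 <= 1.
  by rewrite exprn_ile1 ?shell_frac_ge0 ?shell_frac_le1.
have w0 : 0 <= width i * shell_frac i ^+ 2 by rewrite mulr_ge0 ?width_ge0.
have w1 : width i * shell_frac i ^+ 2 <= 64^-1.
  by apply: le_trans (width_le i); rewrite ler_piMr ?width_ge0.
by rewrite /=; apply/andP; split; lra.
Qed.

Lemma gap_gt0 i : 0 < gap i.
Proof. by rewrite invr_gt0 mulr_gt0 ?ltr0n. Qed.

Lemma gap_le i : gap i <= 128^-1 * 16^-1 ^+ level i.
Proof.
rewrite /gap invfM ler_wpM2l ?invr_ge0 // exprVn lef_pV2 ?posrE ?exprn_gt0
  ?ltr0n //.
by rewrite -natrX ler_nat exp_level_leS.
Qed.

Lemma shell_frac_step j i : (j < i)%N ->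
  level i = level j -> shell_start i = shell_start j ->
  2^-1 ^+ level i <= shell_frac i - shell_frac j.
Proof.
move=> lt_ji eq_lvl eq_start.
have sizeE : shell_size j = shell_size i by rewrite /shell_size eq_lvl.
have lt_mod : (j %% shell_size i < i %% shell_size i)%N.
  move: eq_start lt_ji; rewrite /shell_start sizeE => eq_start.
  rewrite [X in (X < _)%N](divn_eq j (shell_size i)).
  by rewrite [X in (_ < X)%N](divn_eq i (shell_size i)) eq_start ltn_add2l.
rewrite /shell_frac sizeE -mulrBl exprVn -natrX -/(shell_size i).
rewrite -{1}[_^-1]mul1r ler_wpM2r ?invr_ge0 // -natrB 1?ltnW //.
by rewrite ler1n subn_gt0.
Qed.

Lemma alloc_gap j i : (j < i)%N ->
  gap i <= (alloc i).1 - (alloc j).1 + slope i * ((alloc i).2 - (alloc j).2).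
Proof.
move=> lt_ji; apply: le_trans (gap_le i) _ => /=.
have w_ji := width_anti (ltnW lt_ji).
have w0 := width_ge0 i.
have f2 : 0 <= shell_frac j ^+ 2 by rewrite exprn_ge0 ?shell_frac_ge0.
have wf : width i * shell_frac j ^+ 2 <= width j * shell_frac j ^+ 2.
  by rewrite ler_wpM2r.
(* Completing the square, after [width j] is lowered to [width i]. *)
suff : 128^-1 * 16^-1 ^+ level i <=
    128^-1 * (height (shell_start i) - height (shell_start j))
    + width i * (shell_frac i - shell_frac j) ^+ 2 / 2.
  by rewrite /slope; nra.
(* Within one sweep the square alone suffices; between sweeps the lift does. *)
have [[eq_lvl eq_start]|le_shell] := shell_dichotomy lt_ji.
  rewrite eq_start subrr mulr0 add0r.
  have step := shell_frac_step lt_ji eq_lvl eq_start.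
  have step2 : 4^-1 ^+ level i <= (shell_frac i - shell_frac j) ^+ 2.
    have -> : 4^-1 = 2^-1 ^+ 2 :> R by rewrite exprVn -natrX.
    by rewrite exprAC lerXn2r ?nnegrE ?exprn_ge0 ?invr_ge0 //
      (le_trans _ step) ?exprn_ge0 ?invr_ge0.
  have -> : 16^-1 = 4^-1 * 4^-1 :> R by lra.
  rewrite exprMn /width.
  have x0 : 0 <= 4^-1 ^+ level i :> R by rewrite exprn_ge0 ?invr_ge0.
  have := ler_wpM2l x0 step2; lra.
have h := height_shell R le_shell.
have le16 : 16^-1 ^+ level i <= 16^-1 ^+ level j :> R.
  by apply: ler_wiXn2l; rewrite ?invr_ge0 ?invf_le1 ?ler1n //;
    exact/leq_level/ltnW.
have : 0 <= width i * (shell_frac i - shell_frac j) ^+ 2.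
  by rewrite mulr_ge0 ?sqr_ge0.
lra.
Qed.

Lemma alloc_gap_null i : gap i <= (alloc i).1 + slope i * (alloc i).2.
Proof.
apply: le_trans (gap_le i) _ => /=.
have x1 : 16^-1 ^+ level i <= 1 :> R.
  by rewrite exprn_ile1 ?invr_ge0 ?invf_le1 ?ler1n.
have := height_ge0 R (shell_start i).
have : 0 <= width i * shell_frac i ^+ 2 by rewrite mulr_ge0 ?width_ge0 ?sqr_ge0.
by rewrite /slope; lra.
Qed.

(** Slopes increase within a sweep, so the left side is positive only across sweeps; there it is at
    most [width j ^+ 2], which the growth of [height] over the shell of [j] covers. *)
Lemma slope_drop j i : (j < i)%N ->
  slope j * (slope j - slope i) <=
  height (shell_start i) - height (shell_start j).
Proof.
move=> lt_ji; have [[eq_lvl eq_start]|le_shell] := shell_dichotomy lt_ji.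
  rewrite eq_start subrr; apply: mulr_ge0_le0; first exact: slope_ge0.
  have := shell_frac_step lt_ji eq_lvl eq_start.
  have : 0 <= 2^-1 ^+ level i :> R by rewrite exprn_ge0 ?invr_ge0.
  have eq_w : width i = width j by rewrite /width eq_lvl.
  move=> x0 step; rewrite /slope eq_w -mulrBr; apply: mulr_ge0_le0;
    rewrite ?width_ge0 //; lra.
apply: le_trans (height_shell R le_shell).
have s0 := slope_ge0 j; have sw := slope_le_width j.
apply: (@le_trans _ _ (slope j ^+ 2)).
  by rewrite expr2 ler_wpM2l // gerBl slope_ge0.
apply: (@le_trans _ _ (width j ^+ 2));
  first by rewrite lerXn2r ?nnegrE ?width_ge0.
have -> : 16^-1 = 4^-1 * 4^-1 :> R by lra.
rewrite exprMn /width exprMn -expr2 ler_piMl ?sqr_ge0 //; lra.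
Qed.

End Points.

(** * Discrete laws with geometric weights, and integrals against them *)

Section GeometricAtoms.
Variables (d : measure_display) (T : measurableType d) (R : realType).
Variable x : nat -> T.

Definition atom_weight (n : nat) : {nonneg R} := (2^-1 ^+ n.+1)%:nng.

Definition atom (n : nat) : {measure set T -> \bar R} :=
  mscale (atom_weight n) \d_(x n).

Definition geometric_atoms : set T -> \bar R :=
  mseries atom 0.

Lemma geometric_atoms1 (A : set T) :
  (forall n, A (x n)) -> geometric_atoms A = 1%E.
Proof.
move=> Ax; rewrite /geometric_atoms /= /mseries.
rewrite (eq_eseriesr (g := fun k => (1 / (2 ^ (k + 1))%:R)%:E)); last first.
  move=> k _; rewrite /atom /= /mscale /= diracE mem_set // mule1.
  by rewrite exprVn natrX addn1 mul1r.
by apply/cvg_lim => //; have := @cvg_geometric_eseries_half R 1 0;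
  rewrite expr0 divr1.
Qed.

HB.instance Definition _ := Measure.on geometric_atoms.

Let geometric_atomsT : geometric_atoms setT = 1%E.
Proof. exact: geometric_atoms1. Qed.

HB.instance Definition _ :=
  Measure_isProbability.Build _ _ _ geometric_atoms geometric_atomsT.

Definition geometric_law : probability T R := geometric_atoms.

Lemma ge0_integral_geometric_law (f : T -> R) :
  measurable_fun setT f -> (forall v, 0 <= f v) ->
  (\int[geometric_law]_v (f v)%:E =
   \sum_(0 <= n <oo) (2^-1 ^+ n.+1 * f (x n))%:E)%E.
Proof.
move=> mf f0.
have mEf : measurable_fun setT (EFin \o f) by exact/measurable_EFinP.
rewrite ge0_integral_measure_series //; last by move=> v _; rewrite lee_fin.
apply: eq_eseriesr => n _.
rewrite ge0_integral_mscale //; last by move=> v _; rewrite lee_fin.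
by rewrite integral_dirac //= diracT mul1e EFinM.
Qed.

(** The integral is that of the positive part minus that of the negative part, so dropping the
    latter gives an upper bound even without integrability. *)
Lemma integral_geometric_law_le (f : T -> R) (c : R) :
  measurable_fun setT f ->
  (forall n, \sum_(0 <= k < n) 2^-1 ^+ k.+1 * Num.max (f (x k)) 0 <= c) ->
  (\int[geometric_law]_v (f v)%:E <= c%:E)%E.
Proof.
move=> mf fc.
apply: (@le_trans _ _ (\int[geometric_law]_v (Num.max (f v) 0)%:E)%E).
  rewrite integralE.
  rewrite (eq_integral (fun v => (Num.max (f v) 0)%:E)); last first.
    by move=> v _; rewrite funeposE EFin_max.
  by rewrite -[leRHS]sube0 leeB ?integral_ge0.
rewrite ge0_integral_geometric_law; last by move=> v; rewrite le_max lexx orbT.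
  apply: lime_le.
    by apply: is_cvg_nneseries => n _ _;
      rewrite lee_fin mulr_ge0 ?exprn_ge0 ?invr_ge0 // le_max lexx orbT.
  by apply: nearW => n; rewrite sumEFin lee_fin.
exact: measurable_maxr.
Qed.

End GeometricAtoms.

(** * Finite menus and measurable optimal selections *)

Section FiniteMenu.
Variables (R : realType) (menu : nat -> option2 R).

Definition menu_upto (n : nat) : set (option2 R) :=
  [set o | o = ((0, 0), 0) \/ exists2 j, (j < n)%N & o = menu j].

(* Ties are broken in favour of the later option. *)
Fixpoint best (n : nat) (v : R * R) : option2 R :=
  if n is m.+1 then
    if util v (best m v) <= util v (menu m) then menu m else best m v
  else ((0, 0), 0).

Lemma menu_upto_best n v : menu_upto n (best n v).
Proof.
elim: n => [|n IH] /=; first by left.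
case: ifP => _; first by right; exists n.
by case: IH => [->|[j lt_jn ->]]; [left|right; exists j => //; exact: ltnW].
Qed.

Lemma best_max n v o : menu_upto n o -> util v o <= util v (best n v).
Proof.
elim: n o => [|n IH] o /=; first by case=> [->|[j]].
case=> [->|[j lt_jn ->]].
  have le0 : util v ((0, 0), 0) <= util v (best n v) by apply: IH; left.
  by case: ifP => // /(le_trans le0).
have [->|ne_jn] := eqVneq j n.
  by case: ifPn => //; rewrite -ltNge => /ltW.
have lej : util v (menu j) <= util v (best n v).
  by apply: IH; right; exists j => //; rewrite ltn_neqAle ne_jn.
by case: ifP => // /(le_trans lej).
Qed.

Lemma measurable_util_le (f g : R * R -> option2 R) :
  measurable_fun setT f -> measurable_fun setT g ->
  measurable_fun setT (fun v => util v (f v) <= util v (g v)).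
Proof.
have mutil (h : R * R -> option2 R) :
    measurable_fun setT h -> measurable_fun setT (fun v => util v (h v)).
  move=> mh; rewrite /util.
  apply: measurable_funB; last exact: measurableT_comp.
  have mh1 : measurable_fun setT (fun v => (h v).1) by exact: measurableT_comp.
  by apply: measurable_funD; apply: measurable_funM => //;
    exact: measurableT_comp.
by move=> mf mg; apply: measurable_fun_ler; exact: mutil.
Qed.

Lemma measurable_best n : measurable_fun setT (best n).
Proof.
elim: n => [|n IH] /=; first exact: measurable_cst.
by apply: measurable_fun_ifT => //; exact: measurable_util_le.
Qed.

Hypothesis menu_bounds : forall i,
  (0 <= (menu i).1.1 <= 1) /\ (0 <= (menu i).1.2 <= 1).

Lemma menu_upto_mechanism n : is_mechanism (menu_upto n).
Proof.
split; first by left.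
by move=> o [->|[j _ ->]] //=; rewrite lexx ler01.
Qed.

Lemma best_selection n : is_selection (menu_upto n) (best n).
Proof.
split; first exact: measurable_best.
by move=> v _ _; split; [exact: menu_upto_best|move=> o; exact: best_max].
Qed.

Hypothesis price_mono :
  {homo (fun i => (menu i).2) : i j / (i <= j)%N >-> i <= j}.
Hypothesis price_ge0 : forall i, 0 <= (menu i).2.

Lemma best_price_ge0 n v : 0 <= (best n v).2.
Proof. by case: (menu_upto_best n v) => [->|[j _ ->]]. Qed.

(** The buyer may move on to a later option, but never back to one before [i], and later options
    cost at least as much. *)
Lemma best_price n i v : (i < n)%N ->
  (forall o, menu_upto i o -> util v o <= util v (menu i)) ->
  (menu i).2 <= (best n v).2.
Proof.
move=> lt_in best_i; elim: n lt_in => // n IH; rewrite ltnS leq_eqVlt /=.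
case/orP=> [/eqP <-|lt_in].
  by rewrite best_i //; exact: menu_upto_best.
by case: ifP => _; [exact/price_mono/ltnW|exact: IH].
Qed.

End FiniteMenu.

(** * The law, and its infinite revenue *)

Section Gap.
Variable R : realType.
Local Notation height := (@height R).
Local Notation slope := (@slope R).
Local Notation alloc := (@alloc R).
Local Notation gap := (@gap R).

Definition point (i : nat) : (R * R)%type := (2 ^+ i, 2 ^+ i * slope i).

Lemma point_ge0 i : 0 <= (point i).1 /\ 0 <= (point i).2.
Proof. by rewrite mulr_ge0 ?slope_ge0 ?exprn_ge0. Qed.

Definition law : probability (R * R)%type R := geometric_law R point.

Definition gap_menu (i : nat) : option2 R := (alloc i, 2 ^+ i * gap i).

(** The doubling of [2 ^+ i] outweighs the factor [(i + 1) / (i + 2)] lost by [gap]. *)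
Lemma gap_menu_price_mono :
  {homo (fun i => (gap_menu i).2) : i j / (i <= j)%N >-> i <= j}.
Proof.
apply: homo_leq => [i|j i k|i] /=; [exact: lexx|exact: le_trans|].
rewrite exprSr -mulrA ler_wpM2l ?exprn_ge0 // /gap !invfM mulrCA.
rewrite ler_wpM2l ?invr_ge0 //.
rewrite ler_pdivlMr ?ltr0n // mulrC ler_pdivrMr ?ltr0n //.
by rewrite -natrM ler_nat mulSn mul1n addnS !addSn ltnS ltnS leq_addl.
Qed.

Lemma gap_menu_optimal i o : menu_upto gap_menu i o ->
  util (point i) o <= util (point i) (gap_menu i).
Proof.
have c0 : 0 <= 2 ^+ i :> R by rewrite exprn_ge0.
case=> [->|[j lt_ji ->]]; rewrite /util.
  by have := ler_wpM2l c0 (alloc_gap_null R i); rewrite /=; lra.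
have := ler_wpM2l c0 (alloc_gap R lt_ji).
have : 0 <= 2 ^+ j * gap j by rewrite mulr_ge0 ?exprn_ge0 // ltW ?gap_gt0.
by rewrite /=; lra.
Qed.

Lemma series_harmonic_unbounded (c : R) : exists n, c <= series harmonic n.
Proof.
apply: contrapT => bounded; apply: (@dvg_harmonic R).
apply: nondecreasing_is_cvgn.
  by apply: nondecreasing_series => n _ _; exact: harmonic_ge0.
exists c => _ [n _ <-]; rewrite leNgt; apply/negP => /ltW lt_c.
by apply: bounded; exists n.
Qed.

Lemma Rev_law : Rev law = +oo%E.
Proof.
apply: eq_infty => r.
(* Point [k] pays at least [2^k / (128 (k + 1))] with probability [2^-(k+1)], which is
   [harmonic k / 256]. *)
have [n le_n] := series_harmonic_unbounded (256 * r).
apply: le_ereal_sup_tmp; exists (rev_mech law (best gap_menu n)).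
  exists (menu_upto gap_menu n), (best gap_menu n).
  split; last by split => //; exact: best_selection.
  by apply: menu_upto_mechanism => i; exact: alloc_bounds.
have price0 i : 0 <= (gap_menu i).2.
  by rewrite mulr_ge0 ?exprn_ge0 // ltW ?gap_gt0.
have best0 v : 0 <= (best gap_menu n v).2 by exact: best_price_ge0.
rewrite /rev_mech ge0_integral_geometric_law //; last first.
  by apply: measurableT_comp => //; exact: measurable_best.
apply: le_trans (nneseries_lim_ge n _); last first.
  by move=> k _ _; rewrite lee_fin mulr_ge0 ?exprn_ge0 ?invr_ge0.
rewrite sumEFin lee_fin.
apply: (@le_trans _ _ (\sum_(0 <= k < n) 256^-1 * harmonic k)).
  rewrite -mulr_sumr -[r](mulKf (_ : 256 != 0)) ?pnatr_eq0 //.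
  by rewrite ler_wpM2l ?invr_ge0.
apply: ler_sum_nat => k /andP[_ lt_kn].
have := best_price gap_menu_price_mono lt_kn (@gap_menu_optimal k).
move=> /(ler_wpM2l (exprn_ge0 k.+1 (_ : 0 <= 2^-1))) le_k.
apply: le_trans (le_k _); last by rewrite invr_ge0.
have -> : 2^-1 ^+ k.+1 * (gap_menu k).2 = 2^-1 * gap k.
  rewrite exprS -mulrA [_ ^+ k * _]mulrA -exprMn mulVf ?pnatr_eq0 //.
  by rewrite expr1n mul1r.
rewrite /gap invfM mulrA ler_wpM2r ?invr_ge0 //; lra.
Qed.

(** * Bounded aligned revenue for an arbitrary mechanism *)

Section Aligned.
Variables (M : set (option2 R)) (sel : R * R -> option2 R).
Hypotheses (mechM : is_mechanism M) (selM : is_selection M sel).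

Let q1 i := (sel (point i)).1.1.
Let rho i := 2^-1 ^+ i * (sel (point i)).2.
(* Negative prices are excluded, so that only the positive part of the integrand
   of [arev_mech] is summed and [rho j / 2] bounds later occurrences of the
   price at [j]. *)
Let aligned i :=
  parallel (point i) (sel (point i)).1 && (0 < (sel (point i)).2).
(** A potential: the first summand telescopes along aligned points, and [height] pays for the drops
    in slope between sweeps. *)
Let phi i := q1 i * (1 + slope i ^+ 2) + height (shell_start i).

Let M_sel i : M (sel (point i)).
Proof. by have [p1 p2] := point_ge0 i; have [] := selM.2 _ p1 p2. Qed.

Let q1_bounds i : 0 <= q1 i <= 1.
Proof. by have [] := mechM.2 _ (M_sel i). Qed.

Let aligned_q2 i : aligned i -> (sel (point i)).1.2 = slope i * q1 i.
Proof.
rewrite /aligned /parallel /= => /andP[/eqP par _].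
have c0 : 2 ^+ i != 0 :> R by rewrite expf_neq0 ?pnatr_eq0.
by apply: (mulfI c0); rewrite par -mulrA.
Qed.

(** This is the incentive constraint at [point i] divided by [2 ^+ i]; alignment turns the utility
    from the allocation into [q1 i * (1 + slope i ^+ 2)]. *)
Let sel_best i o : M o -> aligned i ->
  rho i <=
    q1 i * (1 + slope i ^+ 2) - (o.1.1 + slope i * o.1.2) + 2^-1 ^+ i * o.2.
Proof.
move=> Mo al; have [p1 p2] := point_ge0 i.
have [_ /(_ o Mo)] := selM.2 _ p1 p2; rewrite /util (aligned_q2 al) /= -/(q1 i).
have c0 : 0 <= 2^-1 ^+ i :> R by rewrite exprn_ge0 ?invr_ge0.
move=> /(ler_wpM2l c0); rewrite /rho.
have : 2^-1 ^+ i * 2 ^+ i = 1 :> R.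
  by rewrite -exprMn mulVf ?pnatr_eq0 // expr1n.
set a := 2^-1 ^+ i; set b := 2 ^+ i; set p := (sel _).2 => ab.
have abE t : a * (b * t) = t by rewrite mulrA ab mul1r.
rewrite !mulrBr !mulrDr -!(mulrA b) !abE; lra.
Qed.

Let rho_first i : aligned i -> rho i <= phi i.
Proof.
move=> al; have := sel_best mechM.1 al; rewrite /= /phi.
have := height_ge0 R (shell_start i); lra.
Qed.

Let rho_step j i : (j < i)%N -> aligned j -> aligned i ->
  rho i <= phi i - phi j + rho j / 2.
Proof.
move=> lt_ji alj ali; have := sel_best (M_sel j) ali.
rewrite (aligned_q2 alj) -/(q1 j).
(* Values at least double from [j] to [i], so the price at [j], rescaled at [i], is at most half of
   [rho j]. *)
have p_j : 2^-1 ^+ i * (sel (point j)).2 <= rho j / 2.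
  have pj0 : 0 <= (sel (point j)).2.
    by move: alj; rewrite /aligned => /andP[_ /ltW].
  rewrite /rho mulrAC -exprSr ler_wpM2r //.
  by apply: ler_wiXn2l; rewrite ?invr_ge0 ?invf_le1 ?ler1n.
have /andP[q0 q11] := q1_bounds j.
have h_ji : 0 <= height (shell_start i) - height (shell_start j).
  rewrite subr_ge0; have [[_ ->]|le_shell] := shell_dichotomy lt_ji;
    first exact: lexx.
  by apply: height_le; apply: leq_trans le_shell; exact: leq_addr.
have drop : q1 j * (slope j * (slope j - slope i)) <=
    height (shell_start i) - height (shell_start j).
  apply: le_trans (ler_wpM2l q0 (slope_drop R lt_ji)) _.
  by rewrite ler_piMl.
rewrite /phi; lra.
Qed.

Let rho_ge0 i : aligned i -> 0 <= rho i.
Proof.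
rewrite /aligned => /andP[_ /ltW p0].
by rewrite mulr_ge0 ?exprn_ge0 ?invr_ge0.
Qed.

Let phi_le i : phi i <= 33.
Proof.
have /andP[q0 q11] := q1_bounds i.
have h := height_le31 R (shell_start i).
have s1 : slope i ^+ 2 <= 1 by rewrite exprn_ile1 ?slope_ge0 ?slope_le1.
have s0 := sqr_ge0 (slope i).
by rewrite /phi; nra.
Qed.

(* The multiple [2 * phi] pays both for the revenue collected so far and for
   [rho j], half of which is inherited by the next aligned point. *)
Let rho_chain n :
  \sum_(0 <= k < n | aligned k) rho k = 0 \/
  exists2 j, (j < n)%N & aligned j /\
    \sum_(0 <= k < n | aligned k) rho k + rho j <= 2 * phi j.
Proof.
elim: n => [|n IH]; first by left; rewrite big_geq.
rewrite big_mkcond big_nat_recr //= -big_mkcond /=.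
case: ifP => [al|_]; last first.
  rewrite addr0; case: IH => [->|[j lt_jn [alj le_j]]]; first by left.
  by right; exists j => //; exact: ltnW.
right; exists n => //; split => //.
case: IH => [->|[j lt_jn [alj le_j]]].
  by have := rho_first al; lra.
by have := rho_step lt_jn alj al; lra.
Qed.

Lemma arev_mech_law_le : (arev_mech law sel <= 33%:E)%E.
Proof.
apply: integral_geometric_law_le => [|n].
  apply: measurable_funM; first by apply: measurableT_comp => //; exact: selM.1.
  apply: measurable_fun_ifT => //; rewrite /parallel.
  have msel1 : measurable_fun setT (fun v => (sel v).1).
    by apply: measurableT_comp => //; exact: selM.1.
  by apply: measurable_fun_eqr; apply: measurable_funM => //;
    exact: measurableT_comp.
have -> : \sum_(0 <= k < n) 2^-1 ^+ k.+1 * Num.max ((sel (point k)).2 *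
      (if parallel (point k) (sel (point k)).1 then 1 else 0)) 0 =
    2^-1 * \sum_(0 <= k < n | aligned k) rho k.
  rewrite mulr_sumr [RHS]big_mkcond /=; apply: eq_bigr => k _.
  rewrite /aligned; case: ifP => _ /=; last by rewrite mulr0 maxxx mulr0.
  rewrite mulr1; case: ltP => _; last by rewrite mulr0.
  by rewrite exprS /rho mulrA.
(* The weights [2^-(k+1)] contribute a factor [1/2], which cancels the [2] in [2 * phi j]. *)
case: (rho_chain n) => [->|[j _ [alj le_j]]]; first by rewrite mulr0.
have := rho_ge0 alj; have := phi_le j; lra.
Qed.

End Aligned.

Lemma ARev_law : (ARev law < +oo)%E.
Proof.
apply: (@le_lt_trans _ _ 33%:E); last exact: ltry.
by apply: ge_ereal_sup => _ [M [sel [mechM [selM ->]]]];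
  exact: (arev_mech_law_le mechM selM).
Qed.

End Gap.

(* Rev(D)/ARev(D) = oo, read in the extended reals:
   either Rev(D) = +oo with ARev(D) finite, or ARev(D) = 0 < Rev(D). *)
Theorem corollary3p4 (R : realType) :
  exists P : probability (R * R)%type R,
    nonneg_supported P /\
    ((Rev P = +oo%E /\ (ARev P < +oo)%E) \/ (ARev P = 0%E /\ (0 < Rev P)%E)).
Proof.
exists (law R); split; first exact/geometric_atoms1/point_ge0.
by left; split; [exact: Rev_law|exact: ARev_law].
Qed.
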